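(* Let $A$ be an automorphism of $\mathbb{P}^2(\mathbb{C})$ whose coefficients are algebraically independent over $\mathbb{Q}$. Then the quadratic transformation $A\sigma$ has no invariant curve (irreducible or not).
   Context: $\sigma=(x_1x_2:x_0x_2:x_0x_1)$ is the standard Cremona involution of $\mathbb{P}^2(\mathbb{C})$. An automorphism of $\mathbb{P}^2(\mathbb{C})$, i.e. an element of $\mathrm{PGL}_3(\mathbb{C})$, has coefficients algebraically independent over $\mathbb{Q}$ if it has a representative in $\mathrm{GL}_3(\mathbb{C})$ whose nine entries are algebraically independent over $\mathbb{Q}$. For a birational map $f$ with (finite) indeterminacy set $\mathrm{Ind}\,f$, an algebraic curve $\Gamma\subset\mathbb{P}^2(\mathbb{C})$ is invariant under $f$ if $\overline{f(\Gamma\setminus\mathrm{Ind}\,f)}=\Gamma$. *)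

(* Defs.v *)
From HB Require Import structures.
From mathcomp Require Import all_boot all_order all_algebra.
From mathcomp Require Import generic_quotient.
From mathcomp Require Import classical_sets reals.
From mathcomp Require Import mpoly.
From mathcomp Require Import complex.

Set Implicit Arguments.
Unset Strict Implicit.
Unset Printing Implicit Defensive.

Import Order.TTheory GRing.Theory Num.Theory.

Local Open Scope ring_scope.
Local Open Scope quotient_scope.
Local Open Scope classical_set_scope.

Section ProjectivePlane.
Variable F : fieldType.

Definition hvec := {v : 'rV[F]_3 | v != 0}.

(* Two nonzero vectors are proportional iff they span the same line, i.e. iff
   they have the same row space. *)
Definition proportional (u v : hvec) : bool := (val u == val v)%MS.

Lemma proportional_equiv : equiv_class_of proportional.
Proof.
split=> [u|u v|v u w]; rewrite /proportional.
- by rewrite submx_refl.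
- by rewrite andbC.
move=> /eqmxP uv /eqmxP vw.
by apply/eqmxP; apply: eqmx_trans uv vw.
Qed.

Canonical proportional_equivRel := EquivRelPack proportional_equiv.

Definition P2 := {eq_quot proportional}.

(* A choice of homogeneous coordinates for p. *)
Definition coords (p : P2) : 'rV[F]_3 := val (repr p).

Definition evalf (Q : {mpoly F[3]}) (v : 'rV[F]_3) : F := Q.@[fun i => v 0 i].

(* For homogeneous Q this does not depend on the choice made by coords. *)
Definition zeros (Q : {mpoly F[3]}) : set P2 :=
  [set p | evalf Q (coords p) = 0].

(* Algebraic curves, irreducible or not. *)
Definition curve (Gamma : set P2) : Prop :=
  exists (d : nat) (Q : {mpoly F[3]}),
    [/\ (0 < d)%N, Q != 0, Q \is d.-homog & Gamma = zeros Q].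

Definition zariski_closed (Z : set P2) : Prop :=
  exists S : set {mpoly F[3]},
    (forall Q, S Q -> exists d : nat, Q \is d.-homog) /\
    Z = \bigcap_(Q in S) zeros Q.

Definition zariski_closure (X : set P2) : set P2 := smallest zariski_closed X.

(* A triple (G_0, G_1, G_2) of forms of the same degree, not all zero,
   represents the rational map x |-> (G_0(x) : G_1(x) : G_2(x)). *)
Definition form_triple (G : 3.-tuple {mpoly F[3]}) : Prop :=
  (exists d : nat, forall i, tnth G i \is d.-homog) /\
  (exists i, tnth G i != 0).

Definition same_map (G H : 3.-tuple {mpoly F[3]}) : Prop :=
  forall i j, tnth G i * tnth H j = tnth G j * tnth H i.

Definition evalt (G : 3.-tuple {mpoly F[3]}) (v : 'rV[F]_3) : 'rV[F]_3 :=
  \row_i evalf (tnth G i) v.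

(* The rational map represented by f is defined at p, with value q: some triple
   G representing the same rational map does not vanish at p, and q = [G(p)].
   As coords q != 0, the equality of row spaces forces G(p) != 0. *)
Definition rat_value (f : 3.-tuple {mpoly F[3]}) (p q : P2) : Prop :=
  exists G, [/\ form_triple G, same_map f G
              & (coords q == evalt G (coords p))%MS].

Definition Ind (f : 3.-tuple {mpoly F[3]}) : set P2 :=
  [set p | ~ exists q, rat_value f p q].

Definition rat_image (f : 3.-tuple {mpoly F[3]}) (X : set P2) : set P2 :=
  [set q | exists2 p, X p & rat_value f p q].

Definition invariant_curve (f : 3.-tuple {mpoly F[3]}) (Gamma : set P2) : Prop :=
  zariski_closure (rat_image f (Gamma `\` Ind f)) = Gamma.

Definition sigma : 3.-tuple {mpoly F[3]} :=
  let x0 := 'X_(0 : 'I_3) in let x1 := 'X_(1 : 'I_3) in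
  let x2 := 'X_(2 : 'I_3) in
  [tuple x1 * x2; x0 * x2; x0 * x1].

(* The automorphism of the plane given by the matrix A acting on column
   vectors of homogeneous coordinates. *)
Definition aut (A : 'M[F]_3) : 3.-tuple {mpoly F[3]} :=
  [tuple \sum_j A i j *: 'X_j | i < 3].

(* f o g *)
Definition rat_comp (f g : 3.-tuple {mpoly F[3]}) : 3.-tuple {mpoly F[3]} :=
  [tuple tnth f i \mPo g | i < 3].

Definition alg_indep (n : nat) (x : 'I_n -> F) : Prop :=
  forall P : {mpoly rat[n]}, mmap (ratr : rat -> F) x P = 0 -> P = 0.

(* A matrix stands for its class in PGL_3, so the independent entries may be
   those of another representative of the same class. *)
Definition generic_aut (A : 'M[F]_3) : Prop :=
  exists2 c : F, c != 0 & alg_indep (fun k => mxvec (c *: A) 0 k).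

End ProjectivePlane.

Arguments sigma {F}.

(* Main.v *)
Require Import Defs.
From mathcomp Require Import all_boot all_order all_algebra fingroup perm.
From mathcomp Require Import generic_quotient fraction zify ring.
From mathcomp Require Import boolp classical_sets reals mpoly complex.

(* Write f = A sigma and suppose that Gamma = Z(Q), with Q a form of degree
   d > 0, is invariant. Then Q(v) = 0 implies both Q(A sigma(v)) = 0 and
   Q(sigma(A^-1 v)) = 0; the latter because the image of Gamma lies in the
   zeros of Q o sigma o A^-1. The curve Gamma meets the line x0 = 0. If it does
   so off the vertices e_1 and e_2, that point is sent to A e_0, so Gamma
   contains the f-orbit of A e_0. If it contains e_k, then Q o A vanishes on the
   orbit of A^-1 e_k under A^-1 sigma.

   Both situations are excluded by specialization. That the orbit of M e_k under
   M sigma lies on a curve of degree d means that all determinants formed from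
   the degree d monomials of its points vanish; these are integral polynomials
   in the entries of M, so if they vanish for M = A or M = adj A with A generic,
   they vanish for every M. But for one explicit integral M the orbit of M e_1 is
   (X_n : (n+1) X_n : (n+1) X_n + 1) with X_n of factorial growth, and this is
   Zariski dense; permuting the coordinates treats the other e_k. *)

Set Implicit Arguments.
Unset Strict Implicit.
Unset Printing Implicit Defensive.

Import Order.TTheory GRing.Theory Num.Theory.

Local Open Scope ring_scope.

(** * Specialization of vanishing conditions *)

(** Rank can only drop under specialization. If [psi] left no common kernel vector, some [n] rows
    would have a minor that is nonzero under [psi], hence nonzero in [S], hence nonzero under the
    injective [phi], which forces [x = 0]. *)
Lemma common_kernel_specialization (S : comNzRingType) (K L : fieldType)
    (phi : {rmorphism S -> K}) (psi : {rmorphism S -> L})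
    (phi_inj : injective phi) (n : nat) (r : nat -> 'rV[S]_n) (x : 'cV[K]_n) :
    x != 0 -> (forall k, map_mx phi (r k) *m x = 0) ->
  exists2 y : 'cV[L]_n, y != 0 & forall k, map_mx psi (r k) *m y = 0.
Proof.
move=> x_neq0 rx0; apply: contrapT => no_y.
pose V N : 'M[S]_(N, n) := \matrix_(i < N) r i.
have rowV N (T : comNzRingType) (f : {rmorphism S -> T}) i :
  row i (map_mx f (V N)) = map_mx f (r i) by rewrite -map_row rowK.
(* While the rank is below [n], the first [N] rows kill some [y != 0]; a row [r k] that does not
   kill [y] raises the rank. *)
have high_rank m : (m <= n)%N -> exists N, (m <= \rank (map_mx psi (V N)))%N.
  elim: m => [|m IHm] lt_mn; first by exists 0%N.
  have [N] := IHm (ltnW lt_mn); rewrite leq_eqVlt => /predU1P[rankV|]; last by exists N.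
  have: cokermx (map_mx psi (V N)) != 0.
    by rewrite cokermx_eq0 /row_full -rankV neq_ltn lt_mn.
  case/matrix0Pn => i [j cij].
  pose y := col j (cokermx (map_mx psi (V N))).
  have y_neq0 : y != 0.
    by apply: contra_neq cij => /colP/(_ i); rewrite !mxE.
  have Vy0 : map_mx psi (V N) *m y = 0 by rewrite /y colE mulmxA mulmx_coker mul0mx.
  have [k rky] : exists k, map_mx psi (r k) *m y != 0.
    apply: contrapT => no_k; apply: no_y; exists y => // k.
    by apply/eqP/negPn/negP => rky; apply: no_k; exists k.
  exists (maxn N k.+1); rewrite rankV; apply: rank_ltmx.
  rewrite ltmxE; apply/andP; split.
    apply/row_subP => l; rewrite rowV.
    have lt_l : (l < maxn N k.+1)%N by rewrite leq_max ltn_ord.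
    by rewrite -(rowV _ _ psi (Ordinal lt_l)) row_sub.
  apply: contra rky => /submxP[D defV].
  have lt_k : (k < maxn N k.+1)%N by rewrite leq_max ltnSn orbT.
  by rewrite -(rowV _ _ psi (Ordinal lt_k)) defV row_mul -!mulmxA Vy0 mulmx0.
have [N rankV] := high_rank n (leqnn n).
have fullV : row_full (map_mx psi (V N)).
  by rewrite /row_full eqn_leq rank_leq_col.
have := fullrowsub_unit fullV.
rewrite -map_mxsub unitmxE det_map_mx unitfE => psi_det.
have unitW : map_mx phi (rowsub (fullrankfun fullV) (V N)) \in unitmx.
  rewrite unitmxE det_map_mx unitfE; apply: contra_neq psi_det => phi_det.
  by rewrite (phi_inj (\det _) 0) ?raddf0.
case/eqP: x_neq0; apply: (can_inj (mulKmx unitW)); rewrite mulmx0.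
apply/row_matrixP => i; rewrite row_mul row0 -map_row row_rowsub.
by rewrite -[RHS](rx0 (fullrankfun fullV i)) map_row rowV.
Qed.

Section MpolyEval.
Variables (n : nat) (R : nzRingType).
Implicit Types P : {mpoly R[n]}.

Lemma rmorph_mmap (S T : comNzRingType) (theta : {rmorphism S -> T})
    (f : R -> S) (h : 'I_n -> S) P :
  theta (mmap f h P) = mmap (theta \o f) (theta \o h) P.
Proof.
rewrite /mmap rmorph_sum; apply: eq_bigr => m _; rewrite rmorphM /=.
by congr (_ * _); rewrite rmorph_prod; apply: eq_bigr => i _; rewrite rmorphXn.
Qed.

Lemma mmap_eqr (S : comNzRingType) (f : R -> S) (h h' : 'I_n -> S) P :
  h =1 h' -> mmap f h P = mmap f h' P.
Proof. by move=> /funext->. Qed.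

Lemma mmap_homogZ (S : comNzRingType) d (f : R -> S) (c : S) (h : 'I_n -> S) P :
  P \is d.-homog -> mmap f (fun i => c * h i) P = c ^+ d * mmap f h P.
Proof.
move/dhomogP => homP; rewrite /mmap mulr_sumr; apply: eq_big_seq => m /homP dm.
rewrite mulrCA; congr (_ * _); have <- : mdeg m = d by [].
rewrite mdegE -prodrXr /mmap1 -big_split /=.
by apply: eq_bigr => i _; rewrite exprMn.
Qed.

End MpolyEval.

Lemma meval_homogZ n (R : comNzRingType) d (c : R) (h : 'I_n -> R)
    (P : {mpoly R[n]}) :
  P \is d.-homog -> P.@[fun i => c * h i] = c ^+ d * P.@[h].
Proof. exact: mmap_homogZ. Qed.

Section HomogSpecialization.
Variables (n d : nat).

Let I := [set m : 'X_{1..n < d.+1} | mdeg m == d].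

Lemma meval_homogE (R : comNzRingType) (P : {mpoly R[n]}) (v : 'I_n -> R) :
    P \is d.-homog ->
  P.@[v] = \sum_(i < #|I|) P@_(enum_val i : 'X_{1..n < d.+1}) *
             mmap1 v (enum_val i : 'X_{1..n < d.+1}).
Proof.
move=> homP; have szP : (msize P <= d.+1)%N.
  by rewrite msizeE; apply/bigmax_leqP_seq => m /(dhomog_mf homP) /= ->.
rewrite -(big_enum_val (fun m : 'X_{1..n < d.+1} => P@_m * mmap1 v m)).
rewrite {1}(mpolywE szP) raddf_sum /= (bigID (mem I)) /=.
rewrite [X in _ + X]big1 ?addr0 => [|m].
  by apply: eq_bigr => m _; rewrite mevalZ mevalX.
rewrite inE => m_d; rewrite (dhomog_nemf_coeff homP) ?scale0r ?raddf0 //.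
Qed.

(** For fixed points, vanishing is a linear condition on the coefficients of a form, so this is a
    common kernel problem whose rows list the degree [d] monomials at the points. *)
Lemma homog_specialization (S : comNzRingType) (K L : fieldType)
    (phi : {rmorphism S -> K}) (psi : {rmorphism S -> L})
    (phi_inj : injective phi) (v : nat -> 'I_n -> S) (Q : {mpoly K[n]}) :
    Q != 0 -> Q \is d.-homog -> (forall k, Q.@[phi \o v k] = 0) ->
  exists P : {mpoly L[n]},
    [/\ P != 0, P \is d.-homog & forall k, P.@[psi \o v k] = 0].
Proof.
move=> Q_neq0 homQ Qv0.
pose mon (i : 'I_#|I|) : 'X_{1..n} := (enum_val i : 'X_{1..n < d.+1}).
have mon_deg i : mdeg (mon i) = d.
  by apply/eqP; have := enum_valP i; rewrite inE.
have mon_inj : injective mon by move=> i j /val_inj/enum_val_inj.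
pose r k := \row_i mmap1 (v k) (mon i).
have mmap1_morph (T : comNzRingType) (f : {rmorphism S -> T}) k m :
    f (mmap1 (v k) m) = mmap1 (f \o v k) m.
  by rewrite rmorph_prod; apply: eq_bigr => i _; rewrite rmorphXn.
have [] := @common_kernel_specialization S K L phi psi phi_inj _ r
              (\col_i Q@_(mon i)).
- apply: contra_neq Q_neq0 => /colP Q0; apply/mpolyP => m; rewrite mcoeff0.
  have [m_d|m_d] := eqVneq (mdeg m) d; last exact: (dhomog_nemf_coeff homQ).
  have lt_m : (mdeg m < d.+1)%N by rewrite m_d.
  have m_in : BMultinom lt_m \in I by rewrite inE; apply/eqP.
  have := Q0 (enum_rank_in m_in (BMultinom lt_m)).
  by rewrite !mxE /mon enum_rankK_in.
- move=> k; apply/colP => j; rewrite !mxE -[RHS](Qv0 k) meval_homogE //.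
  by apply: eq_bigr => i _; rewrite !mxE mmap1_morph mulrC.
move=> y y_neq0 ry0; pose P : {mpoly L[n]} := \sum_i y i 0 *: 'X_[mon i].
have coefP i : P@_(mon i) = y i 0.
  rewrite raddf_sum (bigD1 i) //= mcoeffZ mcoeffX eqxx mulr1 big1 ?addr0 // => j ji.
  by rewrite mcoeffZ mcoeffX (inj_eq mon_inj) (negPf ji) mulr0.
have homP : P \is d.-homog.
  rewrite /P; elim/big_ind: _ => [|p q|i _].
  - exact: dhomog0.
  - exact: dhomogD.
  by apply: dhomogZ; rewrite dhomogX; apply/eqP; apply: mon_deg.
exists P; split=> // [|k].
  by apply: contra_neq y_neq0 => P0; apply/colP => i; rewrite -coefP P0 mcoeff0 mxE.
have /colP/(_ 0) := ry0 k; rewrite !mxE => <-; rewrite meval_homogE //.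
by apply: eq_bigr => i _; rewrite !mxE mmap1_morph coefP mulrC.
Qed.

End HomogSpecialization.

Lemma clear_denominators n (P : {mpoly rat[n]}) :
  exists2 a : int, a != 0 & exists P' : {mpoly int[n]},
    map_mpoly intr P' = a%:~R *: P.
Proof.
elim/mpolyind: P => [|c m P _ _ [a a_neq0 [P' defP']]].
  by exists 1 => //; exists 0; rewrite raddf0 scaler0.
exists (denq c * a); first by rewrite mulf_neq0 ?denq_neq0.
exists ((numq c * a) *: 'X_[m] + denq c *: P').
rewrite raddfD /= !map_mpolyZ map_mpolyX defP' scalerDr !scalerA /=.
rewrite [(denq c * a)%:~R]intrM intrM; congr (_ *: _ + _ *: _).
by rewrite mulrAC [_ * c]mulrC -numqE.
Qed.

(** * A sequence of superpolynomial growth *)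

Lemma poly_eq0_eventually (R : numDomainType) (p : {poly R}) N :
  (forall n, (N <= n)%N -> p.[n.+1%:R] = 0) -> p = 0.
Proof.
move=> p0; apply: (@roots_geq_poly_eq0 _ _ [seq n.+1%:R | n <- iota N (size p)]).
- by apply/allP => x /mapP[n]; rewrite mem_iota => /andP[? _] ->; apply/rootP/p0.
- by rewrite map_inj_uniq ?iota_uniq // => m n /eqP; rewrite eqr_nat => /eqP[].
by rewrite size_map size_iota.
Qed.

(* The number of arrangements n! * \sum_(k <= n) 1 / k! of an n-set. *)
Fixpoint arr (n : nat) : nat := if n is n'.+1 then (n * arr n' + 1)%N else 1%N.

Lemma arr_gt n : (n < arr n)%N.
Proof. by elim: n => //= n IHn; nia. Qed.

(** Passing from [n] to [n.+1] multiplies [arr] by at least [n.+1], which gains one degree; the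
    factor [2 ^ D.+1] pays for replacing [n.+2] by [n.+1]. *)
Lemma arr_superpolynomial C D :
  exists N, forall n, (N <= n)%N -> (C * n.+1 ^ D < arr n)%N.
Proof.
elim: D C => [|D IHD] C.
  by exists C => n leCn; rewrite muln1 (leq_ltn_trans leCn) ?arr_gt.
have [N ltN] := IHD (C * 2 ^ D.+1)%N.
exists N.+1 => -[//|n] /ltN lt_arr /=; rewrite addn1 ltnS.
apply: leq_trans (_ : n.+1 * (C * 2 ^ D.+1 * n.+1 ^ D) <= _)%N; last first.
  by rewrite leq_mul2l ltnW ?orbT.
have : (n.+2 ^ D.+1 <= 2 ^ D.+1 * n.+1 ^ D.+1)%N by rewrite -expnMn leq_exp2r //; lia.
by rewrite [(n.+1 ^ D.+1)%N]expnS; nia.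
Qed.

Lemma poly_lt_arr (p : {poly int}) :
  exists N, forall n, (N <= n)%N -> `|p.[n.+1%:R]| < (arr n)%:R.
Proof.
have [C [D bound]] : exists C D, forall n, (`|p.[n.+1%:R]| <= C * n.+1 ^ D)%N.
  elim/poly_ind: p => [|p c [C [D IHp]]].
    by exists 0%N, 0%N => n; rewrite horner0 absz0.
  exists (C + `|c|)%N, D.+1 => n; rewrite hornerMXaddC.
  have := IHp n; have : (0 < n.+1 ^ D)%N by rewrite expn_gt0.
  move: (n.+1 ^ D)%N (expnS n.+1 D) => e -> e_gt0 le_p.
  set q := p.[_] in le_p *.
  have -> : (n.+1%:R : int) = n.+1 :> int by rewrite -natz.
  nia.
have [N ltN] := arr_superpolynomial C D.
exists N => n /ltN lt_arr; rewrite -abszE [(arr n)%:R]natz ltz_nat.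
exact: leq_ltn_trans (bound n) lt_arr.
Qed.

(* arr n divides the constant coefficient at n + 1, which is too small for
   large n unless it vanishes. *)
Lemma arr_not_algebraic (G : {poly {poly int}}) :
  (forall n, G.[(arr n)%:R].[n.+1%:R] = 0) -> G = 0.
Proof.
elim/poly_ind: G => [//|G c IHG] G0.
have c0 : c = 0.
  have [N ltN] := poly_lt_arr c; apply: (@poly_eq0_eventually _ _ N) => n /ltN.
  have := G0 n; rewrite hornerMXaddC hornerD hornerM -polyC_natr.
  rewrite hornerC natz; set g := (_.[_]); set x := c.[_]; have := arr_gt n.
  move=> arr_gt0 eq0 lt_x.
  have : (arr n %| x)%Z by apply/dvdzP; exists (- g); lia.
  case/dvdzP=> q defx; have [q0|q_neq0] := eqVneq q 0; first by rewrite defx q0 mul0r.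
  have q_ge1 : 1 <= `|q| by lia.
  by move: lt_x; rewrite defx normrM ltNge ler_peMl // normr_nat.
(* Now [G] is divisible by the outer variable, whose value [arr n] is nonzero and can be
   cancelled. *)
rewrite c0 addr0 in G0 *; rewrite IHG ?mul0r // => n.
have /eqP := G0 n; rewrite hornerMX hornerM -polyC_natr hornerC.
rewrite mulf_eq0 natz => /orP[/eqP//|]; have := arr_gt n; lia.
Qed.

(** * Orbits of the Cremona involution composed with a matrix *)

Section Orbit.
Variable R : comNzRingType.
Implicit Types (M : 'M[R]_3) (v : 'I_3 -> R).

(** The map sigma on coordinate vectors, written symmetrically so that it visibly commutes with
    permutations of the coordinates. *)
Definition cremona v i := \prod_(j | j != i) v j.
Definition matvec M v i := \sum_j M i j * v j.

(* Homogeneous coordinates of M e_k and of its iterates under M o sigma. *)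
Fixpoint cremona_orbit M k n : 'I_3 -> R :=
  if n is n'.+1 then matvec M (cremona (cremona_orbit M k n')) else M^~ k.

Lemma cremona0 v : cremona v 0 = v 1 * v 2.
Proof.
rewrite /cremona !big_mkcond !big_ord_recl big_ord0 /= mul1r mulr1.
by congr (v _ * v _); apply: val_inj.
Qed.

Lemma cremona1 v : cremona v 1 = v 0 * v 2.
Proof.
rewrite /cremona !big_mkcond !big_ord_recl big_ord0 /= mul1r mulr1.
by congr (v _ * v _); apply: val_inj.
Qed.

Lemma cremona2 v : cremona v 2 = v 0 * v 1.
Proof.
rewrite /cremona !big_mkcond !big_ord_recl big_ord0 /= !mulr1.
by congr (v _ * v _); apply: val_inj.
Qed.

Lemma sum3 (F : 'I_3 -> R) : \sum_i F i = F 0 + F 1 + F 2.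
Proof.
rewrite !big_ord_recl big_ord0 /= addr0 addrA.
by congr (F _ + F _ + F _); apply: val_inj.
Qed.

Lemma cremonaZ c v i : cremona (fun j => c * v j) i = c ^+ 2 * cremona v i.
Proof.
by rewrite /cremona big_split /= prodr_const cardC1 card_ord.
Qed.

Lemma cremona_perm (s : 'S_3) v i : cremona (v \o s) i = cremona v (s i).
Proof.
rewrite /cremona [RHS](reindex_inj (@perm_inj _ s)) /=.
by apply: eq_bigl => j; rewrite (inj_eq perm_inj).
Qed.

(** Relabelling the coordinates moves the starting vertex, so one explicit matrix serves every
    [k]. *)
Lemma cremona_orbit_perm (s : 'S_3) M k n :
  cremona_orbit (mxsub s s M) k n =1 cremona_orbit M (s k) n \o s.
Proof.
elim: n => [|n IHn] i /=; first by rewrite mxE.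
rewrite /matvec [RHS](reindex_inj (@perm_inj _ s)) /=.
by apply: eq_bigr => j _; rewrite mxE (funext IHn) cremona_perm.
Qed.

End Orbit.

(** Orbit coordinates are integral polynomials in the entries of [M]; this is what makes
    specialization applicable. *)
Lemma rmorph_cremona_orbit (R S : comNzRingType) (phi : {rmorphism R -> S})
    (M : 'M_3) k n :
  phi \o cremona_orbit M k n = cremona_orbit (map_mx phi M) k n.
Proof.
elim: n => [|n IHn]; apply/funext => i /=; first by rewrite mxE.
rewrite rmorph_sum; apply: eq_bigr => j _; rewrite rmorphM mxE -IHn.
by congr (_ * _); rewrite rmorph_prod.
Qed.

(** Rescaling the matrix does not change the projective orbit. It absorbs the scalar in
    [generic_aut] and the one between adjugate and inverse. *)
Lemma cremona_orbitZ (K : idomainType) (c : K) (M : 'M_3) k n : c != 0 ->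
  exists2 a, a != 0 & cremona_orbit (c *: M) k n = fun i => a * cremona_orbit M k n i.
Proof.
move=> c_neq0; elim: n => [|n [a a_neq0 IHn]].
  by exists c => //; apply/funext => i; rewrite /= mxE.
exists (c * a ^+ 2); first by rewrite mulf_neq0 ?expf_neq0.
apply/funext => i; rewrite /= IHn /matvec mulr_sumr; apply: eq_bigr => j _.
by rewrite mxE cremonaZ mulrACA.
Qed.

(* In the coordinates z = x1 / x0 and X = x0 / (x2 - x1), the map M o sigma for
   this matrix M is the skew product (z, X) |-> (z + 1, z X + 1). *)
Definition skew_mx : 'M[int]_3 :=
  \matrix_(i, j) (nth [::] [:: [:: 0; 1; 0]; [:: 1; 1; 0]; [:: 1; 2; -1]] i)`_j.

(** The inverse of the coordinate change to [(z, X)], normalized by [x2 - x1 = 1]. *)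
Definition skew_point (R : comNzRingType) (z X : R) (i : 'I_3) : R :=
  [:: X; z * X; z * X + 1]`_i.

Lemma det_skew_mx : \det skew_mx = 1.
Proof.
rewrite (expand_det_row _ 0) sum3 !mxE /= !mul0r add0r addr0 mul1r.
rewrite /cofactor (expand_det_row _ 0) !big_ord_recl big_ord0 /cofactor !det_mx11 !mxE.
by [].
Qed.

Lemma cremona_orbit_skew_mx n : exists2 c, c != 0 &
  cremona_orbit skew_mx 1 n = fun i => c * skew_point n.+1%:R (arr n)%:R i.
Proof.
elim: n => [|n [c c_neq0 IHn]].
  by exists 1 => //; apply/funext; case=> [[|[|[|]]]] // lt_i; rewrite /= mxE.
(* At [(X, z X, z X + 1)] the first coordinate of the image is [X (z X + 1)], and [X = arr n]
   divides all three coordinates. *)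
exists (c ^+ 2 * (arr n)%:R).
  by rewrite mulf_neq0 ?expf_neq0 // pnatr_eq0 -lt0n (leq_ltn_trans _ (arr_gt n)).
apply/funext => i; rewrite /= IHn /matvec sum3 !cremonaZ cremona0 cremona1 cremona2.
rewrite /= natrD natrM !mxE.
rewrite -[n.+2]addn1 natrD.
by case: i => [[|[|[|]]]] // lt_i; rewrite /skew_point /=; ring.
Qed.

Lemma rmorph_skew_point (R S : comNzRingType) (f : {rmorphism R -> S}) z X :
  f \o skew_point z X = skew_point (f z) (f X).
Proof.
apply/funext; case=> [[|[|[|]]]] // lt_i; rewrite /skew_point /= ?rmorphD ?rmorphM //.
by rewrite rmorph1.
Qed.

Lemma intr_mpolyC n : intr = @mpolyC n int :> (int -> {mpoly int[n]}).
Proof. by apply/funext => c; rewrite -[c in RHS]intz rmorph_int. Qed.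

(** Pulled back to the coordinates [(z, X)], the form becomes a polynomial vanishing at all
    [(n + 1, arr n)], hence zero. The parametrization is birational, so substituting [z] and [X] as
    rational functions of the coordinates recovers [P]. *)
Lemma skew_points_dense (s : 'S_3) d (P : {mpoly int[3]}) :
    P \is d.-homog ->
    (forall n, P.@[skew_point n.+1%:R (arr n)%:R \o s] = 0) ->
  P = 0.
Proof.
move=> homP P0.
pose y : {poly {poly int}} := 'X%:P.
pose G : {poly {poly int}} := mmap intr (skew_point y 'X \o s) P.
have G0 : G = 0.
  apply: arr_not_algebraic => n.
  pose theta : {rmorphism {poly {poly int}} -> int} :=
    horner_eval (n.+1%:R : int) \o horner_eval ((arr n)%:R : {poly int}).
  rewrite -[LHS]/(theta G) [theta G]rmorph_mmap -[RHS](P0 n) /meval.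
  have -> : theta \o intr = idfun.
    by apply/funext => c; rewrite /= rmorph_int rmorph_int intz.
  apply: mmap_eqr => i; rewrite /= -[LHS]/((theta \o skew_point y 'X) (s i)).
  rewrite rmorph_skew_point /= /horner_eval hornerX hornerC hornerX.
  by rewrite -polyC_natr hornerC.
pose F := {fraction {mpoly int[3]}}.
(* The inverse permutation makes [x (s i)] the class of ['X_i]. *)
pose x i : F := tofrac 'X_((s^-1)%g i).
have X_inj (i j : 'I_3) : 'X_i = 'X_j :> {mpoly int[3]} -> i = j.
  move=> /(congr1 (meval (fun k => (k == i)%:R))); rewrite !mevalXU eqxx eq_sym.
  by case: eqVneq.
have x_neq0 : x 0 != 0.
  rewrite tofrac_eq0; apply/eqP => /(congr1 (meval (fun=> 1))).
  by rewrite mevalXU meval0.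
have x21_neq0 : x 2 - x 1 != 0.
  by rewrite subr_eq0 tofrac_eq; apply/eqP => /X_inj/perm_inj.
pose X := (x 2 - x 1)^-1 * x 0; pose z := x 1 / x 0.
pose theta : {rmorphism {poly {poly int}} -> F} :=
  horner_eval X \o map_poly (horner_eval z \o map_poly (intr : int -> F)).
have : theta G = 0 by rewrite G0 rmorph0.
rewrite [theta G]rmorph_mmap.
have -> : theta \o (skew_point y 'X \o s) = fun i => (x 2 - x 1)^-1 * tofrac 'X_i.
  apply/funext => i.
  rewrite -[LHS]/((theta \o skew_point y 'X) (s i)) rmorph_skew_point.
  have -> : theta y = z by rewrite /= map_polyC /= /horner_eval hornerC map_polyX hornerX.
  have -> : theta 'X = X by rewrite /= map_polyX /horner_eval hornerX.
  rewrite -{2}(permK s i) -[tofrac _]/(x (s i)) /X /z.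
  have x0U := divff x_neq0; have x21U := mulVf x21_neq0.
  case: (s i) => [[|[|[|]]]] // lt_i; rewrite /skew_point /=.
  - by congr (_ * x _); apply: val_inj.
  - rewrite mulrCA -mulrA [_^-1 * x 0]mulrC x0U mulr1; congr (_ * x _).
    exact: val_inj.
  rewrite mulrCA -mulrA [_^-1 * x 0]mulrC x0U mulr1 -x21U -mulrDr addrCA subrr addr0.
  by congr (_ * x _); apply: val_inj.
(* Homogeneity extracts the nonzero factor [(x 2 - x 1) ^- d] and leaves [P] itself in the fraction
   field. *)
rewrite (mmap_homogZ _ _ _ homP) => /eqP.
rewrite mulf_eq0 expf_eq0 invr_eq0 (negPf x21_neq0) andbF /=.
have -> : theta \o intr = (@tofrac _ \o @mpolyC 3 int).
  by rewrite -intr_mpolyC; apply/funext => c; rewrite /= -[c]intz !rmorph_int.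
rewrite -rmorph_mmap tofrac_eq0.
have -> : mmap (@mpolyC 3 int) (fun i => 'X_i) P = P.
  by rewrite -[RHS]comp_mpoly_id; apply: mmap_eqr => i; rewrite tnth_mktuple.
by move/eqP.
Qed.

(** A form vanishing on the [phi]-orbit would specialize to a rational form vanishing on the orbit
    of the permuted [skew_mx]. Clearing denominators contradicts density. *)
Lemma cremona_orbit_not_in_curve (S : comNzRingType) (K : fieldType)
    (phi : {rmorphism S -> K}) (psi : {rmorphism S -> rat})
    (phi_inj : injective phi) (N : 'M[S]_3) (s : 'S_3) k c d (Q : {mpoly K[3]}) :
    map_mx psi N = c *: mxsub s s (map_mx intr skew_mx) -> c != 0 -> s k = 1 ->
    Q != 0 -> Q \is d.-homog ->
  ~ forall n, Q.@[cremona_orbit (map_mx phi N) k n] = 0.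
Proof.
move=> psiN c_neq0 sk1 Q_neq0 homQ Q0.
have [|P [P_neq0 homP P0]] :=
    homog_specialization psi phi_inj (v := cremona_orbit N k) Q_neq0 homQ.
  by move=> n; rewrite rmorph_cremona_orbit.
pose w n : 'I_3 -> int := skew_point n.+1%:R (arr n)%:R \o s.
have {}P0 n : P.@[intr \o w n] = 0.
  have := P0 n; rewrite rmorph_cremona_orbit psiN.
  have [a a_neq0 ->] := cremona_orbitZ (mxsub s s (map_mx intr skew_mx)) k n c_neq0.
  rewrite (funext (cremona_orbit_perm _ _ _ _)) sk1 -rmorph_cremona_orbit.
  have [b b_neq0 ->] := cremona_orbit_skew_mx n.
  rewrite (@meval_eq _ _ _ (fun i => (a * b%:~R) * (intr \o w n) i)) => [|i];
    last first.
    by rewrite /= intrM mulrA.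
  rewrite (meval_homogZ _ _ homP) => /eqP.
  rewrite mulf_eq0 expf_eq0 mulf_eq0 intr_eq0 (negPf a_neq0) (negPf b_neq0).
  by rewrite andbF => /eqP.
have [a a_neq0 [P' defP']] := clear_denominators P.
have coefP' m : (P'@_m)%:~R = a%:~R * P@_m by rewrite -mcoeffZ -defP' mcoeff_map_mpoly.
have homP' : P' \is d.-homog.
  apply/dhomogP => m; rewrite mcoeff_msupp; apply: contra_neq_eq => m_d.
  by apply: (@intr_inj rat); rewrite coefP' (dhomog_nemf_coeff homP) ?mulr0.
have P'0 : P' = 0.
  apply: (skew_points_dense (s := s) homP') => n; apply: (@intr_inj rat).
  rewrite /meval rmorph_mmap rmorph0.
  have : (a%:~R *: P).@[intr \o w n] = 0.
    by rewrite mevalZ P0 mulr0.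
  rewrite -defP' rmorph_mmap => <-; congr (mmap _ _ P'); apply/funext => i /=.
    by rewrite mevalC.
  by rewrite mevalXU.
case/eqP: P_neq0; apply/mpolyP => m; rewrite mcoeff0; apply/eqP.
have /eqP := coefP' m; rewrite P'0 mcoeff0 eq_sym mulf_eq0 intr_eq0.
by rewrite (negPf a_neq0).
Qed.

(** * Orbits of generic matrices *)

Lemma cremona_orbit_scale_vanish (K : fieldType) (c : K) (M : 'M_3) k d
    (Q : {mpoly K[3]}) : c != 0 -> Q \is d.-homog ->
    (forall n, Q.@[cremona_orbit M k n] = 0) ->
  forall n, Q.@[cremona_orbit (c *: M) k n] = 0.
Proof.
move=> c_neq0 homQ Q0 n; have [a _ ->] := cremona_orbitZ M k n c_neq0.
by rewrite (meval_homogZ _ _ homQ) Q0 mulr0.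
Qed.

Section GenericOrbits.
Variables (K : numFieldType) (A : 'M[K]_3).
Hypothesis A_generic : generic_aut A.

Let S := {mpoly rat[3 * 3]}.
Let X : 'M[S]_3 := \matrix_(i, j) 'X_(mxvec_index i j).

Let eval_at (B : 'M[rat]_3) : map_mx (meval (mxvec B 0)) X = B.
Proof. by apply/matrixP => i j; rewrite !mxE mevalXU mxvecE. Qed.

Let skew (s : 'S_3) : 'M[rat]_3 := mxsub s s (map_mx intr skew_mx).

Let skew_unit s : skew s \in unitmx.
Proof.
have -> : skew s = row_perm s (col_perm s (map_mx intr skew_mx)).
  by apply/matrixP => i j; rewrite !mxE.
rewrite row_permE col_permE !unitmx_mul !unitmx_perm andbT /=.
by rewrite unitmxE det_map_mx det_skew_mx rmorph1 unitr1.
Qed.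

(** Algebraic independence of the entries of [c *: A] is injectivity of evaluation at them. *)
Lemma generic_aut_phi : exists (phi : {rmorphism S -> K}) (c : K),
  [/\ injective phi, c != 0 & map_mx phi X = c *: A].
Proof.
have [c c_neq0 indep] := A_generic.
exists (mmap (ratr : rat -> K) (fun k => mxvec (c *: A) 0 k)), c; split=> //.
  move=> p q eq_pq; apply/eqP; rewrite -subr_eq0; apply/eqP/indep.
  by rewrite rmorphB /= eq_pq subrr.
by apply/matrixP => i j; rewrite !mxE /= mmapX mmap1U mxvecE mxE.
Qed.

Lemma generic_orbit_not_in_curve k d (Q : {mpoly K[3]}) :
    Q != 0 -> Q \is d.-homog ->
  ~ forall n, Q.@[cremona_orbit A k n] = 0.
Proof.
move=> Q_neq0 homQ Q0; have [phi [c [phi_inj c_neq0 defA]]] := generic_aut_phi.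
pose s := tperm k 1.
have := @cremona_orbit_not_in_curve _ _ phi (meval (mxvec (skew s) 0)) phi_inj
          X s k 1 d Q.
apply; rewrite ?eval_at ?scale1r ?oner_eq0 ?tpermL //.
by rewrite defA; apply: cremona_orbit_scale_vanish homQ Q0.
Qed.

(** The inverse is not polynomial in the entries, so the adjugate, proportional to it, is
    specialized instead. The indeterminates are sent to the inverse of the permuted [skew_mx], whose
    adjugate is a multiple of that matrix. *)
Lemma generic_inv_orbit_not_in_curve k d (Q : {mpoly K[3]}) :
    A \in unitmx -> Q != 0 -> Q \is d.-homog ->
  ~ forall n, Q.@[cremona_orbit (invmx A) k n] = 0.
Proof.
move=> A_unit Q_neq0 homQ Q0; have [phi [c [phi_inj c_neq0 defA]]] := generic_aut_phi.
have adjE (L : fieldType) (B : 'M[L]_3) : B \in unitmx -> \adj B = \det B *: invmx B.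
  by move=> uB; rewrite /invmx uB scalerA divff ?scale1r // -unitfE -unitmxE.
pose s := tperm k 1; pose B := invmx (skew s).
have B_unit : B \in unitmx by rewrite unitmx_inv skew_unit.
have := @cremona_orbit_not_in_curve _ _ phi (meval (mxvec B 0)) phi_inj
          (\adj X) s k (\det B) d Q.
have cA_unit : c *: A \in unitmx by rewrite unitmxZ ?unitfE.
apply; rewrite ?tpermL // ?map_mx_adj.
  by rewrite eval_at adjE // invmxK.
rewrite defA adjE // invmxZ // scalerA.
apply: cremona_orbit_scale_vanish homQ Q0.
by rewrite mulf_neq0 ?invr_eq0 // -unitfE -unitmxE.
Qed.

End GenericOrbits.

(** * Invariant curves *)

Lemma comp_mpoly_homog n k (R : comNzRingType) d e (lq : n.-tuple {mpoly R[k]})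
    (P : {mpoly R[n]}) :
    (forall i, tnth lq i \is e.-homog) -> P \is d.-homog ->
  P \mPo lq \is (d * e).-homog.
Proof.
move=> hom_lq homP; rewrite comp_mpolyEX big_seq.
elim/big_ind: _ => [|p q|m m_P]; [exact: dhomog0 | exact: dhomogD |].
apply: dhomogZ; have <- : mdeg m = d by exact: (dhomog_mf homP).
rewrite mdegE big_distrl /= comp_mpolyX.
elim/big_rec2: _ => [|i D p _ hom_p]; first exact: dhomog1.
by rewrite mulnC; apply: dhomogM => //; apply: dhomogMn.
Qed.

Section Plane.
Local Open Scope classical_set_scope.
Variable K : fieldType.
Implicit Types (Q : {mpoly K[3]}) (A : 'M[K]_3) (u : 'I_3 -> K).

Lemma coords_neq0 (p : P2 K) : coords p != 0.
Proof. by rewrite /coords; case: (repr p). Qed.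

Lemma eqmx_rowZ (v w : 'rV[K]_3) : w != 0 -> (w == v)%MS ->
  exists2 c, c != 0 & w = c *: v.
Proof.
move=> w_neq0 /andP[/sub_rVP[c defw] _]; exists c => //.
by apply: contra_neq w_neq0 => c0; rewrite defw c0 scale0r.
Qed.

Lemma exists_point (v : 'rV[K]_3) : v != 0 -> exists p : P2 K, (coords p == v)%MS.
Proof.
move=> v_neq0; pose h : hvec K := exist _ v v_neq0.
exists (\pi_(P2 K) h)%qT; rewrite /coords.
have /eqmodP : (repr (\pi_(P2 K) h) = h %[mod P2 K])%qT by rewrite reprK.
by [].
Qed.

Lemma zerosE Q d (p : P2 K) (v : 'rV_3) : Q \is d.-homog -> (coords p == v)%MS ->
  zeros Q p <-> evalf Q v = 0.
Proof.
move=> homQ /(eqmx_rowZ (coords_neq0 p))[c c_neq0 defp].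
rewrite /zeros /= /evalf.
rewrite (@meval_eq _ _ _ (fun i => c * v 0 i)) => [|i]; last by rewrite defp mxE.
rewrite (meval_homogZ _ _ homQ); split=> [/eqP|->]; last by rewrite mulr0.
by rewrite mulf_eq0 expf_eq0 (negPf c_neq0) andbF => /eqP.
Qed.

Lemma meval_sigma i u : (tnth sigma i).@[u] = cremona u i.
Proof.
by case: i => [[|[|[|]]]] // lt_i; rewrite (tnth_nth 0) /= mevalM !mevalXU;
  [rewrite -cremona0 | rewrite -cremona1 | rewrite -cremona2];
  congr cremona; apply: val_inj.
Qed.

Lemma meval_aut A i u : (tnth (aut A) i).@[u] = matvec A u i.
Proof.
by rewrite tnth_mktuple raddf_sum /=; apply: eq_bigr => j _; rewrite mevalZ mevalXU.
Qed.

Lemma sigma_homog i : tnth (@sigma K) i \is 2.-homog.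
Proof.
have homX j : ('X_j : {mpoly K[3]}) \is 1.-homog by rewrite dhomogX /= mdeg1.
by case: i => [[|[|[|]]]] // lt_i; rewrite (tnth_nth 0) /=; apply: (dhomogM (d := 1)).
Qed.

Lemma aut_homog A i : tnth (aut A) i \is 1.-homog.
Proof.
rewrite tnth_mktuple; elim/big_ind: _ => [|p q|j _].
- exact: dhomog0.
- exact: dhomogD.
by apply: dhomogZ; rewrite dhomogX /= mdeg1.
Qed.

Lemma rat_comp_homog d e (f g : 3.-tuple {mpoly K[3]}) i :
    (forall j, tnth f j \is d.-homog) -> (forall j, tnth g j \is e.-homog) ->
  tnth (rat_comp f g) i \is (d * e).-homog.
Proof. by move=> homf homg; rewrite tnth_mktuple comp_mpoly_homog. Qed.

Lemma meval_rat_comp (f g : 3.-tuple {mpoly K[3]}) i u :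
  (tnth (rat_comp f g) i).@[u] = (tnth f i).@[fun j => (tnth g j).@[u]].
Proof. by rewrite tnth_mktuple comp_mpoly_meval. Qed.

Lemma meval_aut_sigma A i u :
  (tnth (rat_comp (aut A) sigma) i).@[u] = matvec A (cremona u) i.
Proof.
by rewrite meval_rat_comp meval_aut; apply: eq_bigr => j _; rewrite meval_sigma.
Qed.

Lemma meval_homog0 Q d u : (0 < d)%N -> Q \is d.-homog -> u =1 (fun=> 0) -> Q.@[u] = 0.
Proof.
move=> d_gt0 homQ u0; rewrite (@meval_eq _ _ _ (fun i => 0 * u i)) => [|i].
  by rewrite (meval_homogZ _ _ homQ) expr0n gtn_eqF // mul0r.
by rewrite mul0r u0.
Qed.

Lemma row_funE u : (\row_i u i : 'rV_3) 0 =1 u.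
Proof. by move=> i; rewrite mxE. Qed.

Lemma evalf_row Q u : evalf Q (\row_i u i) = Q.@[u].
Proof. exact/meval_eq/row_funE. Qed.

Lemma evaltZ (G : 3.-tuple {mpoly K[3]}) e c v :
  (forall i, tnth G i \is e.-homog) -> evalt G (c *: v) = c ^+ e *: evalt G v.
Proof.
move=> homG; apply/rowP => i; rewrite !mxE -(meval_homogZ _ _ (homG i)).
by apply: meval_eq => j; rewrite mxE.
Qed.

Lemma evalt_aut_sigma A u :
  evalt (rat_comp (aut A) sigma) (\row_i u i) = \row_i matvec A (cremona u) i.
Proof. by apply/rowP => i; rewrite !mxE evalf_row meval_aut_sigma. Qed.

Lemma aut_sigma_homog A i : tnth (rat_comp (aut A) sigma) i \is 2.-homog.
Proof. exact: (rat_comp_homog i (aut_homog A) sigma_homog). Qed.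

Lemma ord3P (i : 'I_3) : [\/ i = 0, i = 1 | i = 2].
Proof.
by case: i => [[|[|[|]]]] // lt_i;
  [apply: Or31 | apply: Or32 | apply: Or33]; apply: val_inj.
Qed.

(** The involutivity of sigma in a form that tolerates zeros: when no [y i] vanishes, [h] is a
    multiple of sigma(y), and sigma(h) is then a multiple of [y]. *)
Lemma cremona_collinear (h y : 'I_3 -> K) :
    (forall i j, y i * h i = y j * h j) ->
  forall i j, cremona h i * y j = cremona h j * y i.
Proof.
move=> yh; suff: [/\ cremona h 0 * y 1 = cremona h 1 * y 0,
    cremona h 0 * y 2 = cremona h 2 * y 0 & cremona h 1 * y 2 = cremona h 2 * y 1].
  by case=> e01 e02 e12 i j; case: (ord3P i) => ->; case: (ord3P j) => ->.
rewrite !(cremona0, cremona1, cremona2).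
have e01 := yh 0 1; have e02 := yh 0 2; have e12 := yh 1 2.
by split; [ring: e01 | ring: e02 | ring: e12].
Qed.

Lemma comp_autE A (g : 3.-tuple {mpoly K[3]}) i :
  tnth (rat_comp (aut A) g) i = \sum_j A i j *: tnth g j.
Proof.
rewrite !tnth_mktuple raddf_sum; apply: eq_bigr => j _.
by rewrite /= comp_mpolyZ comp_mpolyXU -tnth_nth.
Qed.

Lemma mulX_sigma i : 'X_i * tnth sigma i = 'X_0 * 'X_1 * 'X_2 :> {mpoly K[3]}.
Proof.
by case: (ord3P i) => ->; rewrite (tnth_nth 0) /=; ring.
Qed.

(** * Invariance in terms of the equation of the curve *)

Section InvariantCurve.
Variables (A : 'M[K]_3) (Q : {mpoly K[3]}) (d : nat).
Hypotheses (A_unit : A \in unitmx) (d_gt0 : (0 < d)%N) (homQ : Q \is d.-homog).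
Let f := rat_comp (aut A) sigma.
Hypothesis Q_inv : invariant_curve f (zeros Q).

Lemma invariant_forward u : Q.@[u] = 0 -> Q.@[matvec A (cremona u)] = 0.
Proof.
move=> Qu; set w := matvec A _; pose v : 'rV_3 := \row_i u i.
(* Where the formula for [f] gives the zero vector, the claim holds since a form of positive degree
   vanishes at 0. *)
have [w0|w_neq0] := eqVneq (\row_i w i) 0.
  by apply: (meval_homog0 d_gt0 homQ) => i; have /rowP/(_ i) := w0; rewrite !mxE.
have fu_neq0 : exists i, w i != 0.
  by have /rV0Pn[i wi] := w_neq0; exists i; rewrite mxE in wi.
have v_neq0 : v != 0.
  apply: contra_neq w_neq0 => v0; apply/rowP => i; rewrite !mxE.
  rewrite /w /matvec big1 // => j _; have -> : u = fun i => 0 * u i.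
    by apply/funext => k; rewrite mul0r -[LHS](row_funE u) -/v v0 mxE.
  by rewrite cremonaZ expr0n mul0r mulr0.
have [p defp] := exists_point v_neq0.
have [q defq] := exists_point w_neq0.
have Qp : zeros Q p.
  by apply/(zerosE homQ defp); rewrite evalf_row.
have fpq : rat_value f p q.
  exists f; split=> //.
  - split; first by exists 2%N => i; apply: aut_sigma_homog.
    have [i wi] := fu_neq0; exists i; apply: contra_neq wi => fi0.
    by rewrite /w -meval_aut_sigma fi0 meval0.
  - by move=> i j; rewrite mulrC.
  have [c c_neq0 ->] := eqmx_rowZ (coords_neq0 p) defp.
  rewrite (evaltZ _ _ (@aut_sigma_homog A)) evalt_aut_sigma.
  by apply/eqmxP/(eqmx_trans (eqmxP defq))/eqmx_sym/eqmx_scale; rewrite expf_neq0.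
have : zeros Q q.
  rewrite -[X in X q]Q_inv; apply: sub_gen_smallest; exists p => //; split=> //.
  by apply; exists q.
by move/(zerosE homQ defq); rewrite evalf_row.
Qed.

Lemma invariant_backward u :
  Q.@[u] = 0 -> Q.@[cremona (matvec (invmx A) u)] = 0.
Proof.
pose g := rat_comp sigma (aut (invmx A)); pose Q' := Q \mPo g.
have homQ' : Q' \is (d * (2 * 1)).-homog.
  apply: comp_mpoly_homog homQ => i.
  by apply: rat_comp_homog; [exact: sigma_homog | exact: aut_homog].
have evalQ' w : Q'.@[w] = Q.@[cremona (matvec (invmx A) w)].
  rewrite comp_mpoly_meval; apply: meval_eq => i.
  rewrite meval_rat_comp meval_sigma; congr (cremona _ _).
  by apply/funext => j; rewrite meval_aut.
(* The zeros of [Q'] are closed, so by minimality of the closure it suffices that they contain the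
   image of the curve. *)
have sub_zeros : zeros Q `<=` zeros Q'.
  rewrite -[X in X `<=` _]Q_inv; apply: smallest_sub.
    exists [set Q']; split=> [_ ->|]; first by exists (d * (2 * 1))%N.
    by rewrite bigcap_set1.
  (* The value at [p] may come from a triple [G] other than [f], so only the proportionality of [G]
     and [f] can be used. Applying the inverse of [A] gives a triple [H] proportional to sigma. *)
  move=> q [p [Qp _] [G [_ fG qG]]].
  apply/(zerosE homQ' qG); rewrite /evalf evalQ'.
  pose H i := \sum_j invmx A i j *: tnth G j.
  pose y := coords p 0; pose h i := (H i).@[y].
  have sigmaE i : tnth sigma i = \sum_l invmx A i l *: tnth f l.
    under eq_bigr => l _ do rewrite comp_autE scaler_sumr.
    rewrite exchange_big /= (bigD1 i) //= [X in _ + X]big1 ?addr0 => [|j ji].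
      under eq_bigr => l _ do rewrite scalerA.
      have /matrixP/(_ i i) := mulVmx A_unit; rewrite -scaler_suml !mxE eqxx => ->.
      by rewrite scale1r.
    under eq_bigr => l _ do rewrite scalerA.
    have /matrixP/(_ i j) := mulVmx A_unit; rewrite -scaler_suml !mxE eq_sym.
    rewrite (negPf ji) => ->.
    by rewrite scale0r.
  have sigmaH i j : tnth sigma i * H j = tnth sigma j * H i.
    rewrite !sigmaE /H !mulr_suml; under eq_bigr => l _ do rewrite mulr_sumr.
    rewrite exchange_big; apply: eq_bigr => l _ /=; rewrite mulr_sumr.
    apply: eq_bigr => k _; rewrite -!scalerAl -!scalerAr !scalerA fG.
    by rewrite [_ * invmx A _ _]mulrC.
  (* Each ['X_i * tnth sigma i] equals the product of the three variables, which cancels from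
     [sigmaH]. Unlike [sigmaH], the result remains informative at base points of sigma. *)
  have XH i j : 'X_i * H i = 'X_j * H j.
    have m_neq0 : 'X_0 * 'X_1 * 'X_2 != 0 :> {mpoly K[3]}.
      apply/eqP => /(congr1 (meval (fun=> 1))).
      by rewrite !mevalM !mevalXU meval0 !mulr1 => /eqP; rewrite oner_eq0.
    apply: (mulfI m_neq0); rewrite -{1}(mulX_sigma j) -(mulX_sigma i).
    by rewrite mulrACA [RHS]mulrACA sigmaH [X in X * _ = _]mulrC.
  have yh i j : y i * h i = y j * h j.
    by have := congr1 (meval y) (XH i j); rewrite !mevalM !mevalXU.
  have hE : matvec (invmx A) (evalt G (coords p) 0) = h.
    apply/funext => i; rewrite /h /H raddf_sum; apply: eq_bigr => j _.
    by rewrite /= mevalZ mxE.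
  have /rV0Pn[k yk] := coords_neq0 p.
  have -> : cremona (matvec (invmx A) (evalt G (coords p) 0)) =
            fun i => cremona h k / y k * y i.
    by apply/funext => i; rewrite hE mulrAC (cremona_collinear yh) mulfK.
  by rewrite (meval_homogZ _ _ homQ) [_.@[y]]Qp mulr0.
move=> Qu; rewrite -evalQ'; have [u0|u_neq0] := eqVneq (\row_i u i) 0.
  apply: (meval_homog0 _ homQ'); first by rewrite muln_gt0 d_gt0.
  by move=> i; rewrite -(row_funE u) u0 mxE.
have [p defp] := exists_point u_neq0.
rewrite -evalf_row; apply/(zerosE homQ' defp)/sub_zeros/(zerosE homQ defp).
by rewrite evalf_row.
Qed.

End InvariantCurve.
End Plane.

Lemma matvec_mulmx (R : comNzRingType) (A B : 'M[R]_3) u :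
  matvec A (matvec B u) = matvec (A *m B) u.
Proof.
apply/funext => i; rewrite /matvec; under eq_bigr => j _ do rewrite mulr_sumr.
rewrite exchange_big; apply: eq_bigr => k _; rewrite !mxE mulr_suml.
by apply: eq_bigr => j _; rewrite mulrA.
Qed.

Lemma matvec1 (R : comNzRingType) (u : 'I_3 -> R) : matvec 1%:M u = u.
Proof.
apply/funext => i; rewrite /matvec (bigD1 i) //= big1 => [|j ji]; rewrite mxE.
  by rewrite eqxx mul1r addr0.
by rewrite eq_sym (negPf ji) mul0r.
Qed.

Lemma matvec_delta (R : comNzRingType) (A : 'M[R]_3) k :
  matvec A (fun i => (i == k)%:R) = A^~ k.
Proof.
apply/funext => i; rewrite /matvec (bigD1 k) //= big1 => [|j /negPf->].
  by rewrite eqxx mulr1 addr0.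
by rewrite mulr0.
Qed.

Lemma meval_comp_aut (K : fieldType) (A : 'M[K]_3) Q u :
  (Q \mPo aut A).@[u] = Q.@[matvec A u].
Proof. by rewrite comp_mpoly_meval; apply: meval_eq => i; apply: meval_aut. Qed.

Lemma comp_autV (K : fieldType) (A : 'M[K]_3) i :
  A \in unitmx -> tnth (rat_comp (aut A) (aut (invmx A))) i = 'X_i.
Proof.
move=> A_unit; rewrite comp_autE.
under eq_bigr => j _ do rewrite tnth_mktuple scaler_sumr.
rewrite exchange_big /= (bigD1 i) //= [X in _ + X]big1 => [|k ki].
  under eq_bigr => j _ do rewrite scalerA.
  have /matrixP/(_ i i) := mulmxV A_unit; rewrite -scaler_suml !mxE eqxx => ->.
  by rewrite scale1r addr0.
under eq_bigr => j _ do rewrite scalerA.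
have /matrixP/(_ i k) := mulmxV A_unit; rewrite -scaler_suml !mxE eq_sym (negPf ki) => ->.
by rewrite scale0r.
Qed.

Lemma comp_autK (K : fieldType) (A : 'M[K]_3) Q :
  A \in unitmx -> (Q \mPo aut A) \mPo aut (invmx A) = Q.
Proof.
move=> A_unit; rewrite [LHS]rmorph_mmap -[RHS]comp_mpoly_id.
congr (mmap _ _ Q); apply/funext => i /=; first by rewrite comp_mpolyC.
by rewrite [RHS]tnth_mktuple -(comp_autV i A_unit) [RHS]tnth_mktuple.
Qed.

(** * Intersection of the curve with the line x0 = 0 *)

Section ZerosOnLine.
Variables (K : numClosedFieldType) (Q : {mpoly K[3]}) (d : nat).
Hypotheses (d_gt0 : (0 < d)%N) (homQ : Q \is d.-homog).

Definition vec3 (R : nmodType) (a b c : R) (i : 'I_3) := [:: a; b; c]`_i.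

Let horner_mmap (v : 'I_3 -> {poly K}) t :
  (mmap polyC v Q).[t] = Q.@[fun i => (v i).[t]].
Proof.
rewrite -[LHS]/(horner_eval t (mmap polyC v Q)) rmorph_mmap.
by congr (mmap _ _ Q); apply/funext => c; rewrite /= /horner_eval hornerC.
Qed.

(** A root of [g], the restriction of [Q] to the points [(0, 1, t)], gives one of the first two
    cases. Otherwise [g] is a nonzero constant [c], so [Q] at [(0, s, 1)] is [c s^d], which vanishes
    at [s = 0] because [d] is positive. *)
Lemma zero_on_line :
  [\/ exists2 t, t != 0 & Q.@[vec3 0 1 t] = 0,
      Q.@[fun i => (i == 1)%:R] = 0 | Q.@[fun i => (i == 2)%:R] = 0].
Proof.
pose g := mmap polyC (vec3 0 1 'X) Q.
have gE t : g.[t] = Q.@[vec3 0 1 t].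
  rewrite horner_mmap; apply: meval_eq => i; rewrite /vec3.
  by case: (ord3P i) => -> /=; rewrite !hornerE.
have [size_g|] := eqVneq (size g) 1%N; last first.
  move/closed_rootP => [t /rootP]; rewrite gE => Qt.
  have [t0|t_neq0] := eqVneq t 0; last by apply: Or31; exists t.
  apply: Or32; rewrite -Qt t0; apply: meval_eq => i.
  by case: (ord3P i) => ->.
have /eqP/size_poly1P[c _ gc] := size_g.
apply: Or33; pose h := mmap polyC (vec3 0 'X 1) Q.
have hE t : h.[t] = Q.@[vec3 0 t 1].
  rewrite horner_mmap; apply: meval_eq => i; rewrite /vec3.
  by case: (ord3P i) => -> /=; rewrite !hornerE.
have h_mon : h - c *: 'X^d = 0.
  apply: (@poly_eq0_eventually _ _ 0) => n _; rewrite !hornerE hE.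
  set s := n.+1%:R; have s_neq0 : s != 0 by rewrite pnatr_eq0.
  have -> : vec3 0 s 1 = fun i => s * vec3 0 1 s^-1 i.
    apply/funext => i; rewrite /vec3.
    by case: (ord3P i) => -> /=; rewrite ?mulr0 ?mulr1 ?divff.
  by rewrite (meval_homogZ _ _ homQ) -gE gc hornerC mulrC subrr.
have : h.[0] = 0.
  by move/eqP: h_mon; rewrite subr_eq0 => /eqP->; rewrite !hornerE expr0n gtn_eqF ?mulr0.
rewrite hE => <-; apply: meval_eq => i.
by case: (ord3P i) => ->.
Qed.

End ZerosOnLine.

Theorem mainTheorem9 (R : realType) (A : 'M[R[i]]_3)
    (A_aut : A \in unitmx) (A_generic : generic_aut A) :
  ~ exists Gamma : set (P2 R[i]),
      curve Gamma /\ invariant_curve (rat_comp (aut A) sigma) Gamma.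
Proof.
move=> [_ [[d [Q [d_gt0 Q_neq0 homQ ->]]] Q_inv]].
have fwd := invariant_forward d_gt0 homQ Q_inv.
have bwd := invariant_backward A_aut d_gt0 homQ Q_inv.
have vertex k : Q.@[fun i => (i == k)%:R] = 0 -> False.
  move=> Qk; pose QA := Q \mPo aut A.
  have QA_neq0 : QA != 0.
    by apply: contra_neq Q_neq0 => QA0; rewrite -(comp_autK Q A_aut) -/QA QA0 comp_mpoly0.
  have homQA : QA \is (d * 1).-homog.
    by apply: comp_mpoly_homog homQ => i; apply: aut_homog.
  apply: (generic_inv_orbit_not_in_curve A_generic A_aut QA_neq0 homQA (k := k)).
  (* If [Q] vanishes at [A w], then [bwd] gives its vanishing at sigma(w), so [QA] vanishes at the
     next orbit point, the image of sigma(w) under the inverse of [A]. *)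
  elim=> [|n IHn] /=; rewrite meval_comp_aut.
    by rewrite -matvec_delta matvec_mulmx mulmxV // matvec1.
  rewrite matvec_mulmx mulmxV // matvec1.
  have := bwd _ (etrans (esym (meval_comp_aut _ _ _)) IHn).
  by rewrite matvec_mulmx mulVmx // matvec1.
have [[t t_neq0 Qt]|/vertex//|/vertex//] := zero_on_line d_gt0 homQ.
apply: (generic_orbit_not_in_curve A_generic Q_neq0 homQ (k := 0)).
elim=> [|n IHn] /=; last exact: fwd.
have := fwd _ Qt.
(* Sigma contracts the line x0 = 0 to the vertex [e_0]: [(0, 1, t)] goes to [(t, 0, 0)], and
   [t != 0] can be divided out. *)
have -> : matvec A (cremona (vec3 0 1 t)) = fun i => t * A i 0.
  apply/funext => i; rewrite /matvec sum3 cremona0 cremona1 cremona2 /vec3 /=.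
  by rewrite mul1r !mul0r !mulr0 !addr0 mulrC.
rewrite (meval_homogZ _ _ homQ) => /eqP.
by rewrite mulf_eq0 expf_eq0 (negPf t_neq0) andbF => /eqP.
Qed.
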